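(* Let $\delta>0$ and $\vartheta_1<\vartheta_2$ be real scalars, let $t\in\mathbb{R}$, and let $\vartheta(t)$ be a real number with $\vartheta_1\le\vartheta(t)\le\vartheta_2$. Let $\Gamma$ be an $n\times n$ real symmetric positive definite matrix and let $S\in\mathbb{R}^{n\times n}$ be any matrix such that $\begin{bmatrix}\Gamma & S\\ S^T&\Gamma\end{bmatrix}\ge 0$. Let $\varrho:[t-\vartheta_2,t-\vartheta_1]\to\mathbb{R}^n$ be absolutely continuous with square integrable derivative $\dot\varrho$. Then $$\int_{t-\vartheta_2}^{t-\vartheta_1}e^{\delta(\vartheta_1+s-t)}\dot\varrho^T(s)\,\Gamma\,\dot\varrho(s)\,ds\;\ge\;\frac{\delta}{e^{\delta(\vartheta_2-\vartheta_1)}-1}\begin{bmatrix}\Upsilon_1\\ \Upsilon_2\end{bmatrix}^T\begin{bmatrix}\Gamma&S\\ S^T&\Gamma\end{bmatrix}\begin{bmatrix}\Upsilon_1\\ \Upsilon_2\end{bmatrix},$$ where $\Upsilon_1=\varrho(t-\vartheta(t))-\varrho(t-\vartheta_2)$ and $\Upsilon_2=\varrho(t-\vartheta_1)-\varrho(t-\vartheta(t))$.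
   Context: For symmetric matrices, $A\ge0$ means positive semidefinite. *)

(* Defs.v *)
From mathcomp Require Import all_boot all_order all_algebra.
From mathcomp Require Import all_classical all_reals all_analysis.

Set Implicit Arguments.
Unset Strict Implicit.
Unset Printing Implicit Defensive.

Import Order.TTheory GRing.Theory Num.Theory.
Import numFieldNormedType.Exports.

Local Open Scope classical_set_scope.
Local Open Scope ring_scope.

Definition quad_form (R : realType) (n : nat) (M : 'M[R]_n) (x : 'cV[R]_n) : R :=
  (x^T *m M *m x) ord0 ord0.

Definition posdefmx (R : realType) (n : nat) (M : 'M[R]_n) : Prop :=
  M \is symmetricmx /\ forall x : 'cV[R]_n, x != 0 -> 0 < quad_form M x.

Definition possemidefmx (R : realType) (n : nat) (M : 'M[R]_n) : Prop :=
  M \is symmetricmx /\ forall x : 'cV[R]_n, 0 <= quad_form M x.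

(* Only the values of f on [a, b] matter.  Intervals with u i = v i are
   allowed; they contribute nothing to either sum.  On column vectors `|_| is
   the sup norm, which gives the same notion as the Euclidean norm. *)
Definition absolutely_continuous (R : realType) (V : normedModType R)
    (a b : R) (f : R -> V) : Prop :=
  forall e : R, 0 < e ->
  exists2 d : R, 0 < d &
    forall (m : nat) (u v : 'I_m -> R),
      (forall i, [/\ a <= u i, u i <= v i & v i <= b]) ->
      trivIset [set: 'I_m] (fun i => [set` `]u i, v i[]) ->
      \sum_(i < m) (v i - u i) < d ->
      \sum_(i < m) `|f (v i) - f (u i)| < e.

(* Applied to derive1 f with f absolutely continuous: derive1 is total, but f
   is differentiable almost everywhere, so the arbitrary values of derive1
   elsewhere (endpoints included) affect neither this condition nor any
   Lebesgue integral. *)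
Definition square_integrable (R : realType) (n : nat) (D : set R)
    (g : R -> 'cV[R]_n) : Prop :=
  (@lebesgue_measure R).-integrable D
    (fun s => (\sum_(i < n) (g s i ord0) ^+ 2)%:E).

(* Main.v *)
From HB Require Import structures.
Require Import Defs.
From mathcomp Require Import all_boot all_order all_algebra.
From mathcomp Require Import all_classical all_reals all_analysis.
From mathcomp Require Import measurable_realfun ring lra.

Import Order.TTheory GRing.Theory Num.Theory.
Import numFieldNormedType.Exports.

Local Open Scope classical_set_scope.
Local Open Scope ring_scope.

(* Put a = t - theta2, c = t - theta(t), b = t - theta1.  For every w, Young's
   inequality e^{d(s-b)} x^T G x >= 2 w^T G x - e^{d(b-s)} w^T G w at
   x = rho'(s), integrated over [a, c] with the optimal constant w, gives the
   weighted Jensen inequality: the integral is at least Y1^T G Y1 / K1 with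
   K1 the integral of e^{d(b-s)} over [a, c]; likewise on [c, b] with K2.
   Semidefiniteness of the block matrix at (K2 Y1, -K1 Y2) turns
   Y1^T G Y1 / K1 + Y2^T G Y2 / K2 into the right-hand side, as
   K1 + K2 = (e^{d(b-a)} - 1) / d.

   Integrating w^T G rho' requires the fundamental theorem of calculus for
   absolutely continuous f.  The total variation V of f is absolutely
   continuous, so f = V - (V - f) is a difference of nondecreasing absolutely
   continuous functions.  The Lebesgue-Stieltjes measure of such a function is
   dominated by the Lebesgue measure, its Radon-Nikodym density integrates to
   the increments of the function, and Lebesgue differentiation identifies the
   density with the derivative almost everywhere. *)

(** * Families of separated intervals and sums of total variations *)

Section TotalVariation.
Set Implicit Arguments.
Unset Strict Implicit.
Context {R : realType}.
Implicit Types (a b : R) (f : R -> R) (p q : R * R) (L : seq (R * R)).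

Definition itv_within a b p := [&& a <= p.1, p.1 <= p.2 & p.2 <= b].

(* Holds exactly when the open intervals ]p.1, p.2[ and ]q.1, q.2[ are
   disjoint, empty ones included. *)
Definition itv_sep p q := Num.min p.2 q.2 <= Num.max p.1 q.1.

Lemma itv_sepP p q : itv_sep p q <-> `]p.1, p.2[ `&` `]q.1, q.2[ = set0.
Proof.
rewrite /itv_sep; split=> [h|].
  apply/seteqP; split=> // x []; rewrite /= !in_itv/= => /andP[h1 h2] /andP[h3 h4].
  have : Num.max p.1 q.1 < x by rewrite gt_max h1.
  have : x < Num.min p.2 q.2 by rewrite lt_min h2.
  by move=> h5 h6; have := lt_trans h6 h5; rewrite ltNge h.
apply: contraPT; rewrite -ltNge => h.
(* The midpoint of the intersection, which is a nonempty interval when separation fails. *)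
set x := ((Num.max p.1 q.1 + Num.min p.2 q.2) / 2).
have h1 : Num.max p.1 q.1 < x by rewrite /x; lra.
have h2 : x < Num.min p.2 q.2 by rewrite /x; lra.
move: h1 h2; rewrite gt_max lt_min => /andP[h1 h3] /andP[h2 h4].
by move=> /seteqP[/(_ x)+ _]; apply; rewrite /= !in_itv/= h1 h2 h3 h4.
Qed.

Lemma itv_sepS p p' q : p.1 <= p'.1 -> p'.2 <= p.2 -> itv_sep p q -> itv_sep p' q.
Proof.
move=> h1 h2 h; rewrite /itv_sep.
apply: le_trans (le_trans h _).
  by rewrite le_min !ge_min h2 lexx orbT.
by rewrite ge_max !le_max h1 lexx orbT.
Qed.

(** Lists replace families indexed by ordinals, so that an interval can be exchanged for the cells
    of a partition by concatenation and permutation. *)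
Lemma absolutely_continuous_seq a b (f : R -> R) e : absolutely_continuous a b f ->
  0 < e -> exists2 d : R, 0 < d & forall L, all (itv_within a b) L ->
    pairwise itv_sep L -> \sum_(p <- L) (p.2 - p.1) < d ->
    \sum_(p <- L) `|f p.2 - f p.1| < e.
Proof.
move=> acf e0; have [d d0 h] := acf e e0; exists d => // L Lab Lsep Ld.
have := h (size L) (fun i => (tnth (in_tuple L) i).1)
  (fun i => (tnth (in_tuple L) i).2).
rewrite (big_tnth _ _ L) in Ld; rewrite (big_tnth _ _ L); apply=> //.
  by move=> i; move/allP: Lab => /(_ _ (mem_tnth i (in_tuple L))) /and3P[].
apply/trivIsetP => i j _ _ ij; apply/itv_sepP.
move: i j ij.
suff H (i j : 'I_(size L)) : (i < j)%N ->
    itv_sep (tnth (in_tuple L) i) (tnth (in_tuple L) j).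
  move=> i j; rewrite -val_eqE /= neq_ltn => /orP[/H//|/H].
  by rewrite /itv_sep minC maxC.
move=> ij; rewrite !(tnth_nth (0, 0)).
by move/(pairwiseP (0, 0)): Lsep; apply; rewrite ?inE.
Qed.

(** A partition omits its left endpoint, so [zip (u :: s) s] lists its cells as pairs of
    endpoints. *)
Lemma itv_partition_within u v s : itv_partition u v s ->
  all (itv_within u v) (zip (u :: s) s).
Proof.
elim: s u => // x s ih u uxs.
have uv := itv_partition_le uxs; have xv := itv_partition_le (itv_partition_cons uxs).
have /andP[ux _] : (u < x) && path <%R x s by case: uxs.
rewrite /= /itv_within /= lexx (ltW ux) xv /=.
apply: sub_all (ih _ (itv_partition_cons uxs)) => p /and3P[h1 h2 h3].
by rewrite h2 h3 (le_trans (ltW ux) h1).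
Qed.

Lemma itv_partition_sep u v s : itv_partition u v s ->
  pairwise itv_sep (zip (u :: s) s).
Proof.
elim: s u => // x s ih u uxs.
rewrite -[zip _ _]/((u, x) :: zip (x :: s) s) pairwise_cons ih ?andbT; last exact: itv_partition_cons uxs.
apply: sub_all (itv_partition_within (itv_partition_cons uxs)) => p /and3P[h1 _ _].
by rewrite /itv_sep/= ge_min le_max h1 orbT.
Qed.

Lemma itv_partition_sum u v s (g : R -> R -> R) : itv_partition u v s ->
  (forall x y z, g x z = g x y + g y z) -> (forall x, g x x = 0) ->
  \sum_(p <- zip (u :: s) s) g p.1 p.2 = g u v.
Proof.
move=> + gD g0; elim: s u => [|x s ih] u uxs.
  by rewrite big_nil (itv_partition_nil uxs) g0.
by rewrite -[zip _ _]/((u, x) :: zip (x :: s) s) big_cons ih ?(gD u x v)//; exact: itv_partition_cons uxs.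
Qed.

Lemma variation_zip_pairs u v f s : itv_partition u v s ->
  variation u v f s = \sum_(p <- zip (u :: s) s) `|f p.2 - f p.1|.
Proof.
move=> /variation_zip ->; elim: s u => [|x s ih] u; first by rewrite !big_nil.
by rewrite -[zip (u :: _) _]/((u, x) :: zip (x :: s) s) /= !big_cons -ih.
Qed.

(** Cutting the intervals into cells changes neither their total length nor their separation, so the
    bound on increments holds for all refinements. Suprema over the partitions then give total
    variations, at the price of a weak inequality. *)
Lemma sum_total_variation_le a b f (e d : R) :
  (forall L, all (itv_within a b) L -> pairwise itv_sep L ->
    \sum_(p <- L) (p.2 - p.1) < d -> \sum_(p <- L) `|f p.2 - f p.1| < e) ->
  forall L, all (itv_within a b) L -> pairwise itv_sep L ->
    \sum_(p <- L) (p.2 - p.1) < d ->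
    (\sum_(p <- L) total_variation p.1 p.2 f <= e%:E)%E.
Proof.
move=> H.
(* The suprema are taken one interval at a time: [L] holds the intervals counted by total variation,
   [M] those still counted by increments. *)
suff K : forall L M, all (itv_within a b) (L ++ M) -> pairwise itv_sep (L ++ M) ->
    \sum_(p <- L ++ M) (p.2 - p.1) < d ->
    (\sum_(p <- L) total_variation p.1 p.2 f + \sum_(p <- M) `|f p.2 - f p.1|%:E
      <= e%:E)%E.
  by move=> L; have := K L [::]; rewrite cats0 big_nil adde0.
elim=> [|p L ih] M.
  by move=> h1 h2 h3; rewrite big_nil add0e sumEFin lee_fin ltW// H.
rewrite cat_cons /= big_cons => /andP[/and3P[ap pp pb] LMab].
move=> /andP[pLM LMsep] LMd.
rewrite big_cons -addeA.
set X := (X in (_ + X <= _)%E).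
(* The cells [Z] of a partition of [p] join [M], and the induction hypothesis applies to [L] and
   [Z ++ M]. *)
have key s : itv_partition p.1 p.2 s -> ((variation p.1 p.2 f s)%:E + X <= e%:E)%E.
  move=> ps; pose Z := zip (p.1 :: s) s.
  have LZM : perm_eq (L ++ Z ++ M) (Z ++ (L ++ M)) by rewrite perm_catCA.
  have Zw := itv_partition_within ps.
  have := ih (Z ++ M).
  rewrite (perm_all _ LZM) all_cat LMab andbT.
  rewrite (perm_big _ LZM) big_cat/=.
  have -> : \sum_(q <- Z) (q.2 - q.1) = p.2 - p.1.
    apply: (@itv_partition_sum _ _ _ (fun x y => y - x) ps) => [x y z|x].
      by ring.
    by rewrite subrr.
  have -> : (\sum_(q <- Z ++ M) `|f q.2 - f q.1|%:E =
      (variation p.1 p.2 f s)%:E + \sum_(q <- M) `|f q.2 - f q.1|%:E)%E.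
    by rewrite big_cat/= variation_zip_pairs// sumEFin.
  rewrite addeCA.
  apply=> //.
    by apply: sub_all Zw => q /and3P[h1 h2 h3]; apply/and3P; split => //;
      [exact: le_trans h1|exact: le_trans pb].
  have ZLM : allrel itv_sep Z (L ++ M).
    apply/allrelP => q r qZ rLM.
    have /allP/(_ _ qZ)/and3P[h1 _ h2] := Zw.
    by apply: itv_sepS h1 h2 _; move/allP: pLM; apply.
  have := itv_partition_sep ps; rewrite -/Z => Zsep.
  have sepC : symmetric itv_sep by move=> q r; rewrite /itv_sep minC maxC.
  move: LMsep ZLM; rewrite !pairwise_cat allrel_catr => /and3P[LM Ls Ms].
  move=> /andP[ZL ZM]; rewrite allrel_catr LM Ls Ms ZM Zsep/= !andbT.
  by rewrite allrelC; apply/allrelP => q r qZ rL; rewrite sepC; move/allrelP: ZL; apply.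
(* A degenerate [p] is treated apart, since the one-cell partition used below requires
   [p.1 < p.2]. *)
move: pp; rewrite le_eqVlt => /predU1P[pE|pp].
  rewrite pE total_variationxx.
  by have := key [::]; rewrite variation_nil; apply; split => //=; rewrite pE.
(* Finiteness of [X] lets it cross the inequality, leaving a bound on the variations alone whose
   supremum can be taken. *)
have Xfin : X \is a fin_num.
  rewrite ge0_fin_numE; last first.
    rewrite adde_ge0//; last by apply: sume_ge0.
    rewrite big_seq sume_ge0// => q qL; apply: total_variation_ge0.
    by move: LMab; rewrite all_cat => /andP[/allP/(_ _ qL)/and3P[]].
  apply: le_lt_trans (ltry e); apply: le_trans (key _ (itv_partition1 pp)).
  by rewrite leeDr// lee_fin variation_ge0.
rewrite -leeBrDr//; apply: ge_ereal_sup => _ [_ [s ps <-] <-].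
by rewrite leeBrDr//; exact: key.
Qed.

End TotalVariation.

(** * Total variation of an absolutely continuous function *)

Section AbsolutelyContinuousVariation.
Set Implicit Arguments.
Unset Strict Implicit.
Context {R : realType}.
Variables (a b : R) (f : R -> R).
Hypothesis ab : a <= b.
Hypothesis acf : absolutely_continuous a b f.

(** With [d] the modulus for the bound 1, every piece shorter than [d] has total variation at most
    1, and finitely many pieces of length at most [d / 2] cover the segment. *)
Lemma absolutely_continuous_bounded_variation : bounded_variation a b f.
Proof.
have [d d0 h] := absolutely_continuous_seq acf ltr01.
have small u v : a <= u -> u <= v -> v <= b -> v - u < d ->
    (total_variation u v f <= 1)%E.
  move=> au uv vb uvd; have := sum_total_variation_le h (L := [:: (u, v)]).
  by rewrite !big_seq1/= /itv_within/= au uv vb; exact.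
have steps k x : a <= x -> x <= b -> x - a <= k%:R * (d / 2) ->
    (total_variation a x f <= k%:R%:E)%E.
  elim: k x => [|k ih] x ax xb.
    (* Zero steps leave only [x = a]. *)
    rewrite mul0r subr_le0 => xa.
    by rewrite (_ : x = a) ?total_variationxx//; apply/eqP; rewrite eq_le xa ax.
  move=> xk; set y := Num.max a (x - d / 2).
  have ay : a <= y by rewrite le_max lexx.
  have yx : y <= x by rewrite ge_max ax/= lerBlDr lerDl divr_ge0// ltW.
  rewrite (total_variationD f ay yx) -natr1 EFinD leeD//.
    apply: ih => //; first exact: le_trans yx xb.
    have [h1|h1] := leP a (x - d / 2); rewrite /y.
      by rewrite max_r//; rewrite -natr1 in xk; lra.
    by rewrite max_l ?subrr ?mulr_ge0// ?divr_ge0// ltW.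
  apply: small => //; have : x - d / 2 <= y by rewrite le_max lexx orbT.
  lra.
apply/bounded_variationP => //; rewrite ge0_fin_numE ?total_variation_ge0//.
apply: le_lt_trans (steps (Num.bound ((b - a) / (d / 2))) b ab (lexx b) _) _.
  rewrite -ler_pdivrMr; last lra.
  by apply/ltW/archi_boundP; rewrite !divr_ge0 ?subr_ge0 ?(ltW d0).
exact: ltry.
Qed.

Let V x := fine (total_variation a x f).

Lemma total_variation_fin_num u v : a <= u -> u <= v -> v <= b ->
  total_variation u v f \is a fin_num.
Proof.
move=> au uv vb; apply/bounded_variationP => //.
have := absolutely_continuous_bounded_variation.
by move=> /(bounded_variationr au (le_trans uv vb))/(bounded_variationl uv vb).
Qed.

Lemma fine_total_variationB u v : a <= u -> u <= v -> v <= b ->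
  V v - V u = fine (total_variation u v f).
Proof.
move=> au uv vb; rewrite /V (total_variationD f au uv) fineD ?total_variation_fin_num//.
  by rewrite addrAC subrr add0r.
exact: le_trans uv vb.
Qed.

Lemma absolutely_continuous_total_variation : absolutely_continuous a b V.
Proof.
move=> e e0; have e20 : 0 < e / 2 by rewrite divr_gt0.
(* Half of [e] restores the strict inequality lost in the suprema. *)
have [d d0 h] := absolutely_continuous_seq acf e20; exists d => // m u v uv tuv uvd.
set L := [seq (u i, v i) | i <- enum 'I_m].
have Lw : all (itv_within a b) L.
  by rewrite all_map; apply/allP => i _ /=; apply/and3P; case: (uv i).
have Ls : pairwise itv_sep L.
  rewrite pairwise_map; have := enum_uniq 'I_m; rewrite uniq_pairwise.
  apply: sub_pairwise => i j /= ij; apply/itv_sepP => /=.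
  by move/trivIsetP: tuv; apply.
have Ld : \sum_(p <- L) (p.2 - p.1) < d by rewrite big_map big_enum.
have := sum_total_variation_le h Lw Ls Ld; rewrite big_map big_enum/=.
rewrite (eq_bigr (fun i => `|V (v i) - V (u i)|%:E)) => [|i _].
  by rewrite sumEFin lee_fin => /le_lt_trans; apply; lra.
have [au uvi vb] := uv i.
rewrite fine_total_variationB// ger0_norm ?fine_ge0 ?total_variation_ge0//.
by rewrite fineK// total_variation_fin_num.
Qed.

Lemma fine_total_variation_homo :
  {in `[a, b] &, {homo V : x y / x <= y}}.
Proof.
move=> x y; rewrite !in_itv/= => /andP[ax xb] /andP[ay yb] xy.
by rewrite -subr_ge0 fine_total_variationB// fine_ge0// total_variation_ge0.
Qed.

(** An increment of [f] never exceeds the variation of [f] over the same interval. *)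
Lemma fine_total_variationB_homo :
  {in `[a, b] &, {homo (fun x => V x - f x) : x y / x <= y}}.
Proof.
move=> x y; rewrite !in_itv/= => /andP[ax xb] /andP[ay yb] xy.
suff : f y - f x <= V y - V x by lra.
rewrite fine_total_variationB// -lee_fin fineK ?total_variation_fin_num//.
by apply: le_trans (total_variation_ge f xy); rewrite lee_fin ler_norm.
Qed.

Lemma absolutely_continuousB (g h : R -> R) : absolutely_continuous a b g ->
  absolutely_continuous a b h -> absolutely_continuous a b (fun x => g x - h x).
Proof.
move=> acg ach e e0; have e20 : 0 < e / 2 by rewrite divr_gt0.
have [d1 d10 h1] := acg _ e20; have [d2 d20 h2] := ach _ e20.
exists (Num.min d1 d2); first by rewrite lt_min d10.
move=> m u v uv tuv; rewrite lt_min => /andP[s1 s2].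
have := ltrD (h1 m u v uv tuv s1) (h2 m u v uv tuv s2).
rewrite -splitr; apply: le_lt_trans; rewrite -big_split/=; apply: ler_sum => i _.
have -> : g (v i) - h (v i) - (g (u i) - h (u i)) =
  (g (v i) - g (u i)) - (h (v i) - h (u i)) by ring.
exact: ler_normB.
Qed.

End AbsolutelyContinuousVariation.

(** * Radon-Nikodym density of a Lebesgue-Stieltjes measure *)

Section NondecreasingDensity.
Set Implicit Arguments.
Unset Strict Implicit.
Context {R : realType}.
Implicit Types (G : cumulative R R) (a b : R).
Local Notation mu := (@lebesgue_measure R).
Local Notation LS := lebesgue_stieltjes_measure.

Lemma lebesgue_stieltjes_measure_itvoc G a b : a <= b ->
  LS G `]a, b]%classic = (G b - G a)%:E.
Proof.
move=> ab; rewrite /lebesgue_stieltjes_measure /measure_extension/=.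
by rewrite measurable_mu_extE; [exact: wlength_itv_bnd|exact: is_ocitv].
Qed.

Lemma open_bounded_itv (I : set R) a b : open I -> is_interval I ->
  I `<=` `]a, b[ -> I = `]inf I, sup I[%classic /\ inf I <= sup I.
Proof.
move=> oI iI Iab.
have lI : has_lbound I by exists a => x /Iab/=; rewrite in_itv/= => /andP[/ltW].
have uI : has_ubound I by exists b => x /Iab/=; rewrite in_itv/= => /andP[_ /ltW].
have IE : I = `]inf I, sup I[%classic.
  have := interval_bounded_interior iI lI uI.
  move/interior_id: oI => -> {1}->.
  by apply/seteqP; split => x; rewrite /= in_itv.
(* For the empty set, [inf] and [sup] both take the default value 0. *)
split => //; have [->|/set0P[x Ix]] := eqVneq I set0; first by rewrite inf0 sup0.
by apply: le_trans (ub_le_sup uI Ix); exact: ge_inf.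
Qed.

(** Absolute continuity on the whole line, meant for nondecreasing [G]: the increments are
    nonnegative and carry no absolute value. *)
Definition absolutely_continuous_cumulative (G : R -> R) :=
  forall e : R, 0 < e -> exists2 d : R, 0 < d &
    forall (m : nat) (u v : 'I_m -> R), (forall i, u i <= v i) ->
      trivIset [set: 'I_m] (fun i => `]u i, v i[%classic) ->
      \sum_(i < m) (v i - u i) < d -> \sum_(i < m) (G (v i) - G (u i)) < e.

(** An open set is a countable disjoint union of open intervals. The hypothesis bounds every finite
    partial sum of increments, and the bound passes to the limit. *)
Lemma lebesgue_stieltjes_measure_open_le G a b (e d : R) (W : set R) :
  (forall (m : nat) (u v : 'I_m -> R), (forall i, u i <= v i) ->
      trivIset [set: 'I_m] (fun i => `]u i, v i[%classic) ->
      \sum_(i < m) (v i - u i) < d -> \sum_(i < m) (G (v i) - G (u i)) < e) ->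
  open W -> W `<=` `]a, b[ -> (mu W < d%:E)%E ->
  (LS G W <= e%:E)%E.
Proof.
move=> H oW Wab Wd.
pose I := open_disjoint_itv oW.
have WE : W = \bigcup_k I k by exact: open_disjoint_itv_bigcup.
have IW k : I k `<=` W by rewrite WE; exact: bigcup_sup.
have mI k : measurable (I k) by apply: open_measurable; exact: open_disjoint_itv_open.
have tI : trivIset setT I by exact: open_disjoint_itv_trivIset.
have bI k : I k = `]inf (I k), sup (I k)[%classic /\ inf (I k) <= sup (I k).
  apply: (@open_bounded_itv _ a b); first exact: open_disjoint_itv_open.
    exact: open_disjoint_itv_is_interval.
  exact: subset_trans (IW k) Wab.
(* The half-open interval with the same endpoints contains [I k], and its measure is exactly the
   increment of [G]. *)
have nuI k : (LS G (I k) <= (G (sup (I k)) - G (inf (I k)))%:E)%E.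
  have [IE le] := bI k; rewrite -lebesgue_stieltjes_measure_itvoc//.
  rewrite [X in (LS G X <= _)%E]IE; apply: le_measure; rewrite ?inE.
  - exact: measurable_itv.
  - exact: measurable_itv.
  - exact: subset_itvW.
have muI k : mu (I k) = (sup (I k) - inf (I k))%:E.
  have [IE le] := bI k; rewrite {1}IE lebesgue_measure_itv/= lte_fin.
  move: le; rewrite le_eqVlt => /predU1P[->|->]; first by rewrite ltxx subrr.
  by rewrite EFinB.
have nuW : LS G W = (\sum_(0 <= k <oo) LS G (I k))%E.
  rewrite WE measure_bigcup//; first by apply: eq_eseriesl => k; rewrite in_setT.
  by move=> i _; exact: mI.
have muW : mu W = (\sum_(0 <= k <oo) mu (I k))%E.
  rewrite WE measure_bigcup//; first by apply: eq_eseriesl => k; rewrite in_setT.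
  by move=> i _; exact: mI.
rewrite nuW; apply: lime_le; first exact: is_cvg_nneseries.
apply: nearW => n; rewrite big_mkord.
apply: (@le_trans _ _ (\sum_(k < n) (G (sup (I k)) - G (inf (I k)))%:E)%E).
  by apply: lee_sum => k _; exact: nuI.
rewrite sumEFin lee_fin; apply/ltW/H.
- by move=> k; have [] := bI k.
- apply/trivIsetP => i j _ _ ij.
  have [<- _] := bI i; have [<- _] := bI j.
  by move/trivIsetP: tI; apply.
- rewrite -lte_fin; apply: le_lt_trans Wd; rewrite muW -sumEFin.
  under eq_bigr do rewrite -muI.
  have := @nneseries_lim_ge _ (fun k => mu (I k)) xpredT 0 n.
  by rewrite big_mkord; apply.
Qed.

(** Outer regularity encloses the null set in an open set of Lebesgue measure below [d], whose
    Stieltjes measure is then at most [e]. *)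
Lemma lebesgue_stieltjes_measure_null G a b (N : set R) :
  absolutely_continuous_cumulative G ->
  measurable N -> mu N = 0%E ->
  LS G (N `&` `]a, b]) = 0%E.
Proof.
move=> acG mN N0; apply/eqP; rewrite eq_le measure_ge0 andbT.
apply/lee_addgt0Pr => e e0; rewrite add0e.
have [d d0 H] := acG e e0.
have Noo : (mu N < +oo)%E by rewrite N0.
have [U [oU NU Ud]] := lebesgue_regularity_outer mN Noo d0.
(* The bound on open sets asks for a bounded one; the margin 1 keeps the point [b] inside. *)
pose W := U `&` `]a, b + 1[.
have oW : open W by apply: openI => //; exact: interval_open.
have mU : measurable U by exact: open_measurable.
have mW : measurable W by exact: open_measurable.
have NW : N `&` `]a, b] `<=` W.
  move=> x [/NU Ux]; rewrite /= in_itv/= => /andP[ax xb]; split => //=.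
  by rewrite in_itv/= ax/= (le_lt_trans xb)// ltrDl.
have mNab : measurable (N `&` `]a, b]).
  by apply: measurableI => //; exact: measurable_itv.
apply: (@le_trans _ _ (LS G W)).
  by apply: le_measure; rewrite ?inE.
apply: (lebesgue_stieltjes_measure_open_le (a := a) (b := b + 1) H) => //.
  exact: subIsetr.
apply: le_lt_trans Ud; apply: (@le_trans _ _ (mu U)).
  by apply: le_measure; rewrite ?inE//; exact: subIsetl.
have : (mu (N `|` (U `\` N)) <= mu N + mu (U `\` N))%E.
  by apply: measureU2 => //; exact: measurableD.
by rewrite setDUK// N0 add0e.
Qed.

Lemma cumulative_density G a b : absolutely_continuous_cumulative G -> a <= b ->
  exists2 g : R -> R, mu.-integrable setT (EFin \o g) &
    forall x, a <= x <= b -> G x - G a = \int[mu]_(s in `[a, x]) g s.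
Proof.
move=> acG ab; 
have mab : measurable (`]a, b]%classic : set (measurableTypeR R)).
  exact: measurable_itv.
have nuoo : (LS G `]a, b]%classic < +oo)%E.
  by rewrite lebesgue_stieltjes_measure_itvoc// ltry.
(* Restriction to []a, b]] makes the Stieltjes measure finite, as Radon-Nikodym requires here. *)
pose nur : {finite_measure set _ -> \bar R} := mfrestr mab nuoo.
have dom : nur `<< mu.
  apply/null_content_dominatesP => A mA A0.
  exact: lebesgue_stieltjes_measure_null.
have [g [g0 gfin ig gE]] := radon_nikodym_sigma_finite dom.
have gK : EFin \o (fine \o g) = g by apply/funext => x /=; rewrite fineK.
exists (fine \o g) => [|x /andP[ax xb]]; first by rewrite gK.
(* Adding the single point [a] does not change the Lebesgue integral. *)
have -> : \int[mu]_(s in `[a, x]) (fine \o g) s = fine (\int[mu]_(s in `]a, x]) g s).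
  rewrite /Rintegral integral_itv_obnd_cbnd; last first.
    by apply: measurable_funTS; exact: (measurable_int mu).
  by congr fine; apply: eq_integral => s _ /=; rewrite fineK.
rewrite -gE; last exact: measurable_itv.
have -> : nur `]a, x]%classic = LS G (`]a, x] `&` `]a, b]) by [].
rewrite setIidl; last by apply: subset_itvl; rewrite bnd_simp.
by rewrite lebesgue_stieltjes_measure_itvoc.
Qed.

End NondecreasingDensity.

(** * Fundamental theorem of calculus for absolutely continuous functions *)

Section AbsolutelyContinuousFTC.
Set Implicit Arguments.
Unset Strict Implicit.
Context {R : realType}.
Variables (a b : R).
Hypothesis ab : a <= b.
Implicit Types f G : R -> R.
Local Notation mu := (@lebesgue_measure R).

(** The projection of the line onto [[a, b]]. Composing with it extends a function by constants, so
    that it can define a Stieltjes measure on the whole line. *)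
Let clamp x := Num.max a (Num.min x b).

Let clamp_ge x : a <= clamp x. Proof. by rewrite le_max lexx. Qed.
Let clamp_le x : clamp x <= b. Proof. by rewrite ge_max ab ge_min lexx orbT. Qed.

Let clamp_in x : clamp x \in `[a, b].
Proof. by rewrite in_itv/= clamp_ge clamp_le. Qed.

Let clampK x : a <= x <= b -> clamp x = x.
Proof. by move=> /andP[ax xb]; rewrite /clamp min_l// max_r. Qed.

Let clamp_homo x y : x <= y -> clamp x <= clamp y.
Proof.
by move=> xy; rewrite ge_max clamp_ge/= le_max le_min !ge_min xy lexx !orbT.
Qed.

Let clampB x y : x <= y -> clamp y - clamp x <= y - x.
Proof.
move=> xy; rewrite lerBlDr ge_max; have ax := clamp_ge x.
have mx : Num.min x b <= clamp x by rewrite le_max lexx orbT.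
have my : Num.min y b <= y by rewrite ge_min lexx.
have mb : Num.min y b <= b by rewrite ge_min lexx orbT.
by apply/andP; split; [lra|case: (leP x b) mx => _ mx; lra].
Qed.

Let clamp_itv u v : `]clamp u, clamp v[%classic `<=` `]u, v[%classic.
Proof.
move=> x; rewrite /= !in_itv/= => /andP[ux xv].
have xb := lt_le_trans xv (clamp_le v); have ax := le_lt_trans (clamp_ge u) ux.
move: ux xv; rewrite /clamp gt_max gt_min lt_max lt_min ax/=.
by rewrite [b < x]ltNge (ltW xb)/= orbF [x < a]ltNge (ltW ax)/= => -> /andP[].
Qed.

(** The projection is monotone, does not increase lengths, and sends disjoint open intervals to
    disjoint ones. *)
Lemma absolutely_continuous_clamp G : {in `[a, b] &, {homo G : x y / x <= y}} ->
  absolutely_continuous a b G ->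
  absolutely_continuous_cumulative (G \o clamp).
Proof.
move=> ndG acG e e0; have [d d0 H] := acG e e0; exists d => // m u v uv tuv uvd.
rewrite (eq_bigr (fun i => `|G (clamp (v i)) - G (clamp (u i))|)) => [|i _]; last first.
  by rewrite /= ger0_norm// subr_ge0 ndG ?clamp_in// clamp_homo.
apply: (H m (clamp \o u) (clamp \o v)).
- by move=> i; split; [exact: clamp_ge|exact: clamp_homo|exact: clamp_le].
- apply/trivIsetP => i j _ _ ij; apply/disjoints_subset => x /clamp_itv xi /clamp_itv xj.
  by move/trivIsetP: tuv => /(_ i j I I ij)/disjoints_subset/(_ x xi); apply.
- by apply: le_lt_trans uvd; apply: ler_sum => i _; exact: clampB.
Qed.

Lemma nondecreasing_density G : {in `[a, b] &, {homo G : x y / x <= y}} ->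
  absolutely_continuous a b G ->
  exists2 g : R -> R, mu.-integrable setT (EFin \o g) &
    forall x, a <= x <= b -> G x - G a = \int[mu]_(s in `[a, x]) g s.
Proof.
move=> ndG acG; have ac := absolutely_continuous_clamp ndG acG.
have nd : {homo G \o clamp : x y / x <= y}.
  by move=> x y xy; rewrite /= ndG ?clamp_in// clamp_homo.
(* A cumulative function must be right-continuous: absolute continuity is applied to the single
   interval []x, y[]. *)
have rc : forall x, (G \o clamp) @ at_right x --> (G \o clamp) x.
  move=> x; apply/cvgrPdist_lt => e e0; have [d d0 H] := ac e e0.
  have xd : x < x + d by rewrite ltrDl.
  near=> y.
  have xy : x < y by near: y; exact: nbhs_right_gt.
  have yd : y < x + d by near: y; exact: nbhs_right_lt.
  rewrite distrC ger0_norm ?subr_ge0 ?nd// ?(ltW xy)//.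
  have := H 1 (fun=> x) (fun=> y).
  rewrite !big_ord1; apply.
  - by move=> ?; exact: ltW.
  - by apply/trivIsetP => i j _ _ /eqP[]; rewrite (ord1 i) (ord1 j).
  - by rewrite ltrBlDl.
pose Gc : cumulative R R :=
  HB.pack (G \o clamp) (isCumulative.Build R _ R (G \o clamp) nd rc).
have [g ig gE] := @cumulative_density _ Gc a b ac ab; exists g => // x xab.
by rewrite -gE//= !clampK// lexx.
Unshelve. all: by end_near. Qed.

(** The density is the difference of those of [V] and [V - f], with [V] the total variation. *)
Lemma absolutely_continuous_density f : absolutely_continuous a b f ->
  exists2 g : R -> R, mu.-integrable setT (EFin \o g) &
    forall x, a <= x <= b -> f x - f a = \int[mu]_(s in `[a, x]) g s.
Proof.
move=> acf; have acV := absolutely_continuous_total_variation ab acf.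
have [g1 ig1 g1E] := nondecreasing_density (fine_total_variation_homo ab acf) acV.
have [g2 ig2 g2E] := nondecreasing_density (fine_total_variationB_homo ab acf)
  (absolutely_continuousB acV acf).
have igS g x : mu.-integrable setT (EFin \o g) -> mu.-integrable `[a, x] (EFin \o g).
  by move=> ig; apply: integrableS ig => //; exact: measurable_itv.
exists (fun x => g1 x - g2 x) => [|x xab].
  exact: (integrableB measurableT ig1 ig2).
rewrite RintegralB//; try exact: igS.
by rewrite -g1E// -g2E//; ring.
Qed.

Lemma absolutely_continuous_FTC f : absolutely_continuous a b f ->
  exists g : R -> R, [/\ mu.-integrable setT (EFin \o g),
    forall x, a <= x <= b -> f x - f a = \int[mu]_(s in `[a, x]) g s &
    {ae mu, forall x, a < x < b -> is_derive x 1 f (g x)}].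
Proof.
move=> acf; have [g ig gE] := absolutely_continuous_density acf.
exists g; split => //.
have igy y : mu.-integrable [set` Interval (BLeft a) (BRight y)] (EFin \o g).
  by apply: integrableS ig => //; exact: measurable_itv.
have locg : locally_integrable setT g by exact: open_integrable_locally openT ig.
have := @FTC1 R g (BLeft a) igy locg; apply: filterS; first exact: (ae_filter_ringOfSetsType mu).
move=> x /= H /andP[ax xb].
have [|dF F'] := H; first by rewrite lte_fin.
set F := (fun y => \int[mu]_(t in `[a, y]) g t) in dF F'.
(* The integral formula holds only on [[a, b]], but an interior [x] has a neighborhood there, which
   is enough for the derivative. *)
have FE : {near x, (fun y => F y + f a) =1 f}.
  near=> y; rewrite /F -gE ?subrK//; apply/andP; split.
    by near: y; exact: lt_le_nbhsr.
  by near: y; exact: lt_le_nbhsl.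
apply: near_eq_is_derive FE _.
rewrite -[g x]addr0 -F' derive1E; apply: is_deriveD.
exact: derivableP.
Unshelve. all: by end_near. Qed.

End AbsolutelyContinuousFTC.

(** * Quadratic forms, Young's inequality and reciprocal convexity *)

Section QuadraticForms.
Set Implicit Arguments.
Unset Strict Implicit.
Context {R : realType} {n : nat}.
Implicit Types (M Gamma S : 'M[R]_n) (x y z w : 'cV[R]_n) (p q r : R).

Definition bilinear_form M x y : R := (x^T *m M *m y) ord0 ord0.
Local Notation B := bilinear_form.

Lemma bilinear_formDl M x y z : B M (x + y) z = B M x z + B M y z.
Proof. by rewrite /B linearD/= !mulmxDl mxE. Qed.

Lemma bilinear_formDr M x y z : B M z (x + y) = B M z x + B M z y.
Proof. by rewrite /B mulmxDr mxE. Qed.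

Lemma bilinear_formZl M r x y : B M (r *: x) y = r * B M x y.
Proof. by rewrite /B linearZ/= -!scalemxAl mxE. Qed.

Lemma bilinear_formZr M r x y : B M x (r *: y) = r * B M x y.
Proof. by rewrite /B -scalemxAr mxE. Qed.

Lemma bilinear_formC M x y : B M^T x y = B M y x.
Proof.
rewrite /B (_ : x^T *m M^T *m y = (y^T *m M *m x)^T); first by rewrite mxE.
by rewrite !trmx_mul trmxK mulmxA.
Qed.

Lemma bilinear_formE M x y :
  B M x y = \sum_(j < n) (x^T *m M) ord0 j * y j ord0.
Proof. by rewrite /B mxE. Qed.

Lemma quad_formE M x : quad_form M x = B M x x. Proof. by []. Qed.

Lemma quad_form0 M : quad_form M 0 = 0.
Proof. by rewrite /quad_form mulmx0 mxE. Qed.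

Lemma quad_formZ M r x : quad_form M (r *: x) = r ^+ 2 * quad_form M x.
Proof. by rewrite !quad_formE bilinear_formZl bilinear_formZr mulrA. Qed.

Lemma posdefmx_ge0 M x : posdefmx M -> 0 <= quad_form M x.
Proof.
move=> [_ M0]; have [->|/M0/ltW//] := eqVneq x 0; by rewrite quad_form0.
Qed.

Lemma posdefmx_sym M : posdefmx M -> M^T = M.
Proof. by case=> /is_hermitianmxP; rewrite expr0 scale1r map_mx_id. Qed.

(** Each product of two coordinates is at most the sum of squares in absolute value. This crude
    bound turns square integrability into finiteness of the weighted integral. *)
Lemma quad_form_le M x :
  quad_form M x <= (\sum_(i < n) \sum_(j < n) `|M i j|) * \sum_(k < n) x k ord0 ^+ 2.
Proof.
rewrite quad_formE bilinear_formE.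
under eq_bigr do rewrite mxE mulr_suml.
rewrite exchange_big/= mulr_suml; apply: ler_sum => i _.
rewrite mulr_suml; apply: ler_sum => j _; rewrite mxE.
have le1 (k : 'I_n) : x k ord0 ^+ 2 <= \sum_(k < n) x k ord0 ^+ 2.
  by rewrite (bigD1 k)//= lerDl sumr_ge0// => l _; exact: sqr_ge0.
have xy : `|x i ord0 * x j ord0| <= \sum_(k < n) x k ord0 ^+ 2.
  have := le1 i; have := le1 j; move: (x i ord0) (x j ord0) (\sum_(k < n) _).
  move=> u v s vs us; rewrite ler_norml; have := sqr_ge0 (u + v); have := sqr_ge0 (u - v).
  by move=> h1 h2; apply/andP; split; nra.
rewrite mulrAC (le_trans (ler_norm _))// normrM mulrC.
exact: ler_wpM2l.
Qed.

(** The right side minus the left side is [r * quad_form Gamma (x - r^-1 *: w)]. *)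
Lemma young_bilinear_form Gamma w x r : posdefmx Gamma -> 0 < r ->
  2 * B Gamma w x - r^-1 * quad_form Gamma w <= r * quad_form Gamma x.
Proof.
move=> G r0; have := posdefmx_ge0 (x - r^-1 *: w) G.
rewrite quad_formE -scaleN1r !(bilinear_formDl, bilinear_formDr).
rewrite !(bilinear_formZl, bilinear_formZr) -[B _ x w]bilinear_formC (posdefmx_sym G).
rewrite -!quad_formE => h; rewrite -subr_ge0 (le_trans (mulr_ge0 (ltW r0) h))//.
by rewrite le_eqVlt; apply/orP; left; apply/eqP; field; rewrite gt_eqF.
Qed.

Lemma quad_form_block Gamma S x y :
  quad_form (block_mx Gamma S S^T Gamma) (col_mx x y) =
  quad_form Gamma x + 2 * B S x y + quad_form Gamma y.
Proof.
rewrite /quad_form tr_col_mx mul_row_block mul_row_col !mulmxDl.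
have -> (u v w z : 'M[R]_1) : (u + v + (w + z)) ord0 ord0 =
    u ord0 ord0 + v ord0 ord0 + (w ord0 ord0 + z ord0 ord0) by rewrite !mxE.
rewrite -[X in _ + X + _]/(B S^T y x) bilinear_formC -[X in _ + (X + _)]/(B S x y).
ring.
Qed.

(** The right side minus the left side is [(p * q * (p + q))^-1] times the block form at
    [(q x, - p y)]. *)
Lemma reciprocally_convex Gamma S x y p q :
  possemidefmx (block_mx Gamma S S^T Gamma) -> 0 < p -> 0 < q ->
  (p + q)^-1 * quad_form (block_mx Gamma S S^T Gamma) (col_mx x y) <=
  p^-1 * quad_form Gamma x + q^-1 * quad_form Gamma y.
Proof.
move=> [_ /(_ (col_mx (q *: x) (- p *: y)))] + p0 q0.
rewrite !quad_form_block !quad_formZ bilinear_formZl bilinear_formZr.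
move: (quad_form _ _) (quad_form _ _) (B _ _ _) => u v s h.
have pq : 0 < (p * q * (p + q))^-1 by rewrite invr_gt0 !mulr_gt0// addr_gt0.
rewrite -subr_ge0 (le_trans (mulr_ge0 (ltW pq) h))//.
by rewrite le_eqVlt; apply/orP; left; apply/eqP; field; rewrite !gt_eqF// addr_gt0.
Qed.

End QuadraticForms.

(** * Weighted Jensen inequality, with densities in place of derivatives *)

Section WeightedIntegralBound.
Set Implicit Arguments.
Unset Strict Implicit.
Context {R : realType}.
Local Notation mu := (@lebesgue_measure R).

(* The integral of a nonnegative function is the supremum of the integrals of
   the nonnegative simple functions below it, so no measurability is needed. *)
Lemma ge0_le_integral_restrict (D D' : set R) (f g : R -> \bar R) :
  (forall x, D x -> 0 <= f x)%E -> (forall x, D' x -> 0 <= g x)%E ->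
  (forall x, (f \_ D) x <= (g \_ D') x)%E ->
  (\int[mu]_(x in D) f x <= \int[mu]_(x in D') g x)%E.
Proof.
move=> f0 g0 fg; rewrite !ge0_integralE//.
apply: ereal_sup_le => _ [k kf <-]; exists k => // x.
exact: le_trans (kf x) (fg x).
Qed.

Lemma integrable_expR (r c x y : R) :
  mu.-integrable `[x, y] (EFin \o (fun s => expR (r * (c - s)))).
Proof.
apply: continuous_compact_integrable; first exact: segment_compact.
apply: continuous_subspaceT => s.
apply: (@continuous_comp _ _ _ (fun s => r * (c - s)) expR); last exact: continuous_expR.
by apply: cvgM; [exact: cvg_cst|apply: cvgB; [exact: cvg_cst|exact: cvg_id]].
Qed.

Lemma Rintegral_expR (r c x y : R) : r != 0 -> x < y ->
  \int[mu]_(s in `[x, y]) expR (r * (c - s)) =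
  (expR (r * (c - x)) - expR (r * (c - y))) / r.
Proof.
move=> r0 xy; pose F (s : R) : R := - r^-1 * expR (r * (c - s)).
have dF (s : R) : is_derive s (1 : R) F (expR (r * (c - s))).
  apply: is_derive_eq; rewrite /GRing.scale/=; field.
  by [].
have cF : continuous F.
  by move=> s; apply/differentiable_continuous/derivable1_diffP; case: (dF s).
rewrite /Rintegral (@continuous_FTC2 _ _ F)//.
- by rewrite /= /F; field.
- apply: continuous_subspaceT => s.
  apply: (@continuous_comp _ _ _ (fun s => r * (c - s)) expR); last exact: continuous_expR.
  by apply: cvgM; [exact: cvg_cst|apply: cvgB; [exact: cvg_cst|exact: cvg_id]].
- split.
  + by move=> s _; case: (dF s).
  + exact: cvg_at_right_filter (cF x).
  + exact: cvg_at_left_filter (cF y).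
- by move=> s _; rewrite derive1E; apply: derive_val; exact: dF.
Qed.

Variables (n : nat) (delta a b : R) (Gamma : 'M[R]_n) (rho : R -> 'cV[R]_n).
Variable g : 'I_n -> R -> R.
Hypothesis delta0 : 0 < delta.
Hypothesis G0 : posdefmx Gamma.
Hypothesis ig : forall i, mu.-integrable setT (EFin \o g i).
Hypothesis rhoE : forall i x, a <= x <= b ->
  rho x i ord0 - rho a i ord0 = \int[mu]_(s in `[a, x]) g i s.

(** The column of densities stands for the derivative of [rho]; the two are identified almost
    everywhere only in the final theorem. *)
Let dvec s := \col_(i < n) g i s.
Let h s := expR (delta * (s - b)) * quad_form Gamma (dvec s).
Hypothesis ih : mu.-integrable `[a, b] (EFin \o h).

Let igS i x y : mu.-integrable `[x, y] (EFin \o g i).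
Proof. exact: integrableS (ig i). Qed.

Lemma Rintegral_segmentD (f : R -> R) x y z : x <= y -> y <= z ->
  mu.-integrable `[x, z] (EFin \o f) ->
  \int[mu]_(s in `[x, z]) f s =
  \int[mu]_(s in `[x, y]) f s + \int[mu]_(s in `[y, z]) f s.
Proof.
move=> xy yz fi; have := @Rintegral_itvB _ f (BLeft x) (BRight z) y fi.
rewrite !bnd_simp => /(_ xy yz) /eqP; rewrite subr_eq addrC => /eqP ->.
rewrite Rintegral_itv_obnd_cbnd//; apply: integrableS fi => //.
by apply: subset_itvr; rewrite bnd_simp.
Qed.

Let rhoB i x y : a <= x -> x <= y -> y <= b ->
  (rho y - rho x) i ord0 = \int[mu]_(s in `[x, y]) g i s.
Proof.
move=> ax xy yb; have := rhoE i (x := y); have := rhoE i (x := x).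
rewrite ax yb (le_trans xy yb) (le_trans ax xy) => /(_ isT) hx /(_ isT).
rewrite (@Rintegral_segmentD _ a x y)// -hx !mxE => hy; lra.
Qed.

(** Closed form of the integral of [expR (delta * (b - s))] over [[x, y]]. *)
Let K x y := (expR (delta * (b - x)) - expR (delta * (b - y))) / delta.

Let K_gt0 x y : x < y -> 0 < K x y.
Proof. by move=> xy; rewrite divr_gt0// subr_gt0 ltr_expR ltr_pM2l// ltrD2l ltrN2. Qed.

Let ihS x y : a <= x -> y <= b -> mu.-integrable `[x, y] (EFin \o h).
Proof.
move=> ax yb; apply: integrableS ih => //.
move=> s; rewrite /= !in_itv/= => /andP[xs sy].
by rewrite (le_trans ax xs) (le_trans sy yb).
Qed.

Lemma young_integral w x y : a <= x -> x < y -> y <= b ->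
  2 * bilinear_form Gamma w (rho y - rho x) - K x y * quad_form Gamma w <=
  \int[mu]_(s in `[x, y]) h s.
Proof.
move=> ax xy yb; pose c j : R := (w^T *m Gamma) ord0 j.
have mxy : measurable (`[x, y]%classic : set R) by exact: measurable_itv.
have icg j : mu.-integrable `[x, y] (EFin \o (fun s => c j * g j s)).
  exact: (@integrableZl _ _ _ mu `[x, y] (measurable_itv _) (c j) (EFin \o g j)) (igS j x y).
have il : mu.-integrable `[x, y] (EFin \o (fun s => \sum_(j < n) c j * g j s)).
  rewrite (_ : _ \o _ = fun s => (\sum_(j < n) (c j * g j s)%:E)%E); last first.
    by apply/funext => s /=; rewrite sumEFin.
  by apply: integrable_sum => // j _; exact: icg.
have iE := integrable_expR delta b x y.
(* The constant row [c] is [w^T Gamma], so the pairing with the increment is the integral of a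
   finite linear combination of the densities. *)
have -> : bilinear_form Gamma w (rho y - rho x) =
    \int[mu]_(s in `[x, y]) \sum_(j < n) c j * g j s.
  rewrite bilinear_formE /Rintegral.
  under eq_integral do rewrite -sumEFin.
  rewrite integral_sum//=.
  rewrite (eq_bigr (fun j => (c j * (rho y - rho x) j ord0)%:E)) => [|j _].
    by rewrite sumEFin.
  rewrite (rhoB _ ax (ltW xy) yb) -RintegralZl//.
  rewrite /Rintegral fineK//.
  exact: (@integrable_fin_num _ _ _ mu `[x, y] (measurable_itv _)) (icg j).
rewrite /K -Rintegral_expR ?gt_eqF//.
have il2 : mu.-integrable `[x, y] (EFin \o (fun s => 2 * \sum_(j < n) c j * g j s)).
  exact: (@integrableZl _ _ _ mu `[x, y] (measurable_itv _) 2) il.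
have iEw : mu.-integrable `[x, y]
    (EFin \o (fun s => expR (delta * (b - s)) * quad_form Gamma w)).
  exact: (@integrableZr _ _ _ mu `[x, y] (measurable_itv _) (quad_form Gamma w)) iE.
rewrite -RintegralZl// -RintegralZr// -RintegralB//.
apply: le_Rintegral => //.
- exact: (@integrableB _ _ _ mu `[x, y] (measurable_itv _)) il2 iEw.
- exact: ihS.
move=> s _; rewrite /h.
(* Young's inequality with the weight itself as [r]; its inverse integrates to [K x y]. *)
have := young_bilinear_form w (dvec s) G0 (expR_gt0 (delta * (s - b))).
have -> : (expR (delta * (s - b)))^-1 = expR (delta * (b - s)).
  by rewrite -expRN -mulrN opprB.
rewrite bilinear_formE.
by under eq_bigr do rewrite [X in _ * X]mxE.
Qed.

Lemma weighted_Cauchy_Schwarz x y : a <= x -> x < y -> y <= b ->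
  (K x y)^-1 * quad_form Gamma (rho y - rho x) <= \int[mu]_(s in `[x, y]) h s.
Proof.
move=> ax xy yb; have K0 := K_gt0 xy.
(* This [w] maximizes the lower bound: the two terms become [2 / K] and [- 1 / K] times the form of
   the increment. *)
have := young_integral ((K x y)^-1 *: (rho y - rho x)) ax xy yb.
rewrite bilinear_formZl quad_formZ -quad_formE; apply: le_trans.
by rewrite le_eqVlt; apply/orP; left; apply/eqP; field; rewrite gt_eqF.
Qed.

Lemma weighted_reciprocally_convex S c : a < b -> a <= c <= b ->
  possemidefmx (block_mx Gamma S S^T Gamma) ->
  delta / (expR (delta * (b - a)) - 1) *
    quad_form (block_mx Gamma S S^T Gamma) (col_mx (rho c - rho a) (rho b - rho c)) <=
  \int[mu]_(s in `[a, b]) h s.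
Proof.
move=> ab /andP[ac cb] hS.
have Kab x : K a x + K x b = K a b by rewrite /K; field; rewrite gt_eqF.
have -> : delta / (expR (delta * (b - a)) - 1) = (K a b)^-1.
  by rewrite /K subrr mulr0 expR0 invf_div.
(* At [c = a] or [c = b] one of the two [K] vanishes and reciprocal convexity does not apply, but
   one increment is zero and a single Jensen inequality suffices. The zero vector is written
   [0 *: 0] to cancel the cross term. *)
move: ac; rewrite le_eqVlt => /predU1P[<-|ac].
  rewrite subrr quad_form_block quad_form0 add0r -(scale0r 0) bilinear_formZl.
  by rewrite mul0r mulr0 add0r; exact: weighted_Cauchy_Schwarz.
move: cb; rewrite le_eqVlt => /predU1P[->|cb].
  rewrite subrr quad_form_block quad_form0 addr0 -(scale0r 0) bilinear_formZr.
  by rewrite mul0r mulr0 addr0; exact: weighted_Cauchy_Schwarz.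
rewrite -(Kab c) (Rintegral_segmentD (ltW ac) (ltW cb) ih).
apply: le_trans (reciprocally_convex _ _ hS (K_gt0 ac) (K_gt0 cb)) _.
by apply: lerD; apply: weighted_Cauchy_Schwarz => //; exact: ltW.
Qed.

End WeightedIntegralBound.

(** * Passage from column-valued functions to their coordinates *)

Section ColumnValuedFunctions.
Set Implicit Arguments.
Unset Strict Implicit.
Context {R : realType} {n : nat}.

Lemma absolutely_continuous_coord (a b : R)
    (rho : R -> 'cV[R]_n) (i : 'I_n) : absolutely_continuous a b rho ->
  absolutely_continuous a b (fun s => rho s i ord0).
Proof.
move=> ac e e0; have [d d0 H] := ac e e0; exists d => // m u v uv tuv uvd.
apply: le_lt_trans (H m u v uv tuv uvd); apply: ler_sum => k _.
(* The norm on columns is the largest absolute value of an entry, so it dominates each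
   coordinate. *)
rewrite [leRHS]/Num.Def.normr/= mx_normrE.
apply: le_trans (le_bigmax _ _ (i, ord0)); by rewrite !mxE.
Qed.

Lemma derive1_col (rho : R -> 'cV[R]_n) (x : R)
    (l : 'I_n -> R) :
  (forall i, is_derive x 1 (fun s => rho s i ord0) (l i)) ->
  derive1 rho x = \col_(i < n) l i.
Proof.
move=> H; rewrite derive1E derive_mx; last first.
  by apply/derivable_mxP => i j; rewrite (ord1 j); case: (H i).
by apply/colP => i; rewrite !mxE; apply: derive_val; exact: H.
Qed.

Lemma measurable_quad_form (M : 'M[R]_n)
    (g : 'I_n -> R -> R) (D : set R) : (forall i, measurable_fun D (g i)) ->
  measurable_fun D (fun s => quad_form M (\col_(i < n) g i s)).
Proof.
move=> mg.
rewrite (_ : (fun s => _) = fun s => \sum_(j < n) (\sum_(i < n) g i s * M i j) * g j s).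
  apply: measurable_sum => j; apply: measurable_funM => //.
  by apply: measurable_sum => i; apply: measurable_funM.
apply/funext => s; rewrite quad_formE bilinear_formE; apply: eq_bigr => j _.
rewrite !mxE; congr (_ * _); apply: eq_bigr => i _; by rewrite !mxE.
Qed.

End ColumnValuedFunctions.

(** * The integral inequality for the derivative of [rho] *)

Theorem lemma2p7 (R : realType) (n : nat) (delta theta1 theta2 t : R)
    (theta : R -> R) (Gamma S : 'M[R]_n) (rho : R -> 'cV[R]_n)
    (hdelta : 0 < delta) (htheta12 : theta1 < theta2)
    (htheta : theta1 <= theta t <= theta2)
    (hGamma : posdefmx Gamma)
    (hS : possemidefmx (block_mx Gamma S S^T Gamma))
    (hrho : absolutely_continuous (t - theta2) (t - theta1) rho)
    (hdrho : square_integrable `[t - theta2, t - theta1] (derive1 rho)) :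
  let Upsilon1 := rho (t - theta t) - rho (t - theta2) in
  let Upsilon2 := rho (t - theta1) - rho (t - theta t) in
  delta / (expR (delta * (theta2 - theta1)) - 1)
    * quad_form (block_mx Gamma S S^T Gamma) (col_mx Upsilon1 Upsilon2)
  <= \int[lebesgue_measure]_(s in `[t - theta2, t - theta1])
       (expR (delta * (theta1 + s - t)) * quad_form Gamma (derive1 rho s)).
Proof.
cbv zeta.
set a := t - theta2; set b := t - theta1; set c := t - theta t.
have ab : a < b by rewrite /a /b; lra.
have acb : a <= c <= b by rewrite /a /b /c; move: htheta => /andP[? ?]; apply/andP; split; lra.
have -> : theta2 - theta1 = b - a by rewrite /a /b; ring.
have expE s : expR (delta * (theta1 + s - t)) = expR (delta * (s - b)).
  by congr (expR (_ * _)); rewrite /b; ring.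
under [X in _ <= X]eq_Rintegral do rewrite expE.
have [g gP] := choice (fun i =>
  absolutely_continuous_FTC (ltW ab) (absolutely_continuous_coord i hrho)).
have ig i : lebesgue_measure.-integrable setT (EFin \o g i) by case: (gP i).
(* [h] is built on the densities and is measurable; [I] is the integrand of the statement. *)
pose h s := expR (delta * (s - b)) * quad_form Gamma (\col_(i < n) g i s).
pose I s := expR (delta * (s - b)) * quad_form Gamma (derive1 rho s).
have h0 s : 0 <= h s by rewrite mulr_ge0 ?expR_ge0 ?posdefmx_ge0.
have I0 s : 0 <= I s by rewrite mulr_ge0 ?expR_ge0 ?posdefmx_ge0.
have mD : measurable (`[a, b]%classic : set R) by exact: measurable_itv.
have mh : measurable_fun (`[a, b]%classic : set R) h.
  apply: measurable_funM.
    apply: measurable_funTS; apply: continuous_measurable_fun => s.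
    apply: (@continuous_comp _ _ _ (fun s => delta * (s - b)) expR); last exact: continuous_expR.
    by apply: cvgM; [exact: cvg_cst|apply: cvgB; [exact: cvg_id|exact: cvg_cst]].
  apply: measurable_quad_form => i; apply: measurable_funTS.
  by apply/measurable_EFinP; exact: measurable_int (ig i).
have aehI : {ae lebesgue_measure, forall s, a < s < b -> h s = I s}.
  (* There are finitely many coordinates, so one null set serves them all. *)
  have : {ae lebesgue_measure, forall s, forall i, a < s < b ->
      is_derive s 1 (fun s => rho s i ord0) (g i s)}.
    by apply: filter_forall => i; case: (gP i).
  apply: filterS; first exact: (ae_filter_ringOfSetsType lebesgue_measure).
  by move=> s H sab; rewrite /h /I (derive1_col (fun i => H i sab)).
(* One inequality suffices: [h], set to zero on a null set, lies below [I], and this comparison asks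
   for no measurability of [I]. *)
have hI : (\int[lebesgue_measure]_(s in `[a, b]) (h s)%:E <= \int[lebesgue_measure]_(s in `[a, b]) (I s)%:E)%E.
  case: aehI => N [mN N0 hIN].
  (* The endpoints join the null set because [aehI] concerns the open interval. *)
  pose N' := N `|` ([set a] `|` [set b]).
  have mN' : measurable N' by apply: measurableU => //; exact: measurableU.
  have N'0 : lebesgue_measure N' = 0%E.
    rewrite /N' measureU0//; first exact: measurableU.
    by rewrite measureU0//; exact: lebesgue_measure_set1.
  rewrite (ge0_negligible_integral mN' _ _ _ N'0)//; last 2 first.
  - exact/measurable_EFinP.
  - by move=> s _; rewrite lee_fin.
  apply: ge0_le_integral_restrict => [s _|s _|s]; rewrite ?lee_fin//.
  rewrite !patchE; case: ifPn => [|_]; last first.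
    by case: ifPn => // _; rewrite lee_fin.
  rewrite inE => -[Ds N's]; rewrite ifT ?inE// lee_fin.
  suff -> : h s = I s by [].
  have Ns : ~ N s by move=> Ns; apply: N's; left.
  have : (~` N) s by []. 
  move=> /(subsetCl hIN); apply.
  have sa : s != a by apply/eqP => sa; apply: N's; right; left.
  have sb : s != b by apply/eqP => sb; apply: N's; right; right.
  by move: Ds; rewrite /= in_itv/= !le_eqVlt eq_sym (negbTE sa) (negbTE sb).
(* On [[a, b]] the weight is at most 1, since [s <= b], and the form is at most [C] times the
   integrable sum of squares. *)
have Ioo : (\int[lebesgue_measure]_(s in `[a, b]) (I s)%:E < +oo)%E.
  pose C := \sum_(i < n) \sum_(j < n) `|Gamma i j|.
  have C0 : 0 <= C by apply: sumr_ge0 => i _; exact: sumr_ge0.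
  have iC : lebesgue_measure.-integrable `[a, b] (fun s =>
      C%:E * (\sum_(i < n) (derive1 rho s i ord0) ^+ 2)%:E)%E.
    exact: (@integrableZl _ _ _ lebesgue_measure `[a, b] (measurable_itv _)) hdrho.
  have := @integrable_fin_num _ _ _ lebesgue_measure `[a, b] (measurable_itv _) _ iC.
  move=> Cfin; apply: (le_lt_trans _ (_ : _ < +oo)%E); last first.
    by rewrite ltey_eq; apply/orP; left; exact: Cfin.
  have sq0 s : 0 <= \sum_(i < n) (derive1 rho s i ord0) ^+ 2.
    by apply: sumr_ge0 => i _; exact: sqr_ge0.
  apply: ge0_le_integral_restrict => [s _|s _|s].
  - by rewrite lee_fin.
  - by rewrite -EFinM lee_fin mulr_ge0.
  rewrite !patchE; case: ifPn => //; rewrite inE/= in_itv/= => /andP[_ sb].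
  rewrite -EFinM lee_fin; apply: le_trans (quad_form_le Gamma (derive1 rho s)).
  rewrite ler_piMl ?posdefmx_ge0// -expR0 ler_expR.
  by rewrite mulr_ge0_le0 ?(ltW hdelta)// subr_le0.
have ih : lebesgue_measure.-integrable `[a, b] (EFin \o h).
  apply/integrableP; split; first exact/measurable_EFinP.
  under eq_integral do rewrite gee0_abs ?lee_fin//.
  exact: le_lt_trans hI Ioo.
apply: (@le_trans _ _ (\int[lebesgue_measure]_(s in `[a, b]) h s)).
  apply: weighted_reciprocally_convex => //.
  by move=> i x xab; case: (gP i) => _ H _; exact: H.
(* [fine] preserves the order only between finite values, hence the two finiteness goals. *)
rewrite /Rintegral; apply: fine_le => //.
- exact: (@integrable_fin_num _ _ _ lebesgue_measure `[a, b] (measurable_itv _)) ih.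
- rewrite ge0_fin_numE; first exact: Ioo.
  by apply: integral_ge0 => s _; rewrite lee_fin; exact: I0.
Qed.
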